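(* For any $n\in\mathbb{N}_+$ and any $f:\mathbb{R}^d\to\mathbb{R}$ with modulus of regularity $\omega:[0,d]\to\mathbb{R}$ on $[0,1]^d$, there is a ReLU MLP $\Phi:\mathbb{R}^d\to\mathbb{R}$ with width at most $8d(n+1)^d$, depth at most $\lceil\log_2 d\rceil+5$, and no more than $18d(n+1)^d$ nonzero parameters satisfying $$\sup_{\mathbf{x}\in\mathbb{R}^d}\Big(|f(\mathbf{x})-\Phi(\mathbf{x})|-\bar\omega\big(\operatorname{dist}_{[0,1]^d}(\mathbf{x})\big)\Big)\le\bar\omega\left(\frac d{2n}\right),$$ where $\bar\omega:[0,\infty)\to[0,\infty)$ is the extension of $\omega$ given by $\bar\omega(x)=\omega(x)$ for $x\in[0,d]$ and $\bar\omega(x)=\omega(d)$ for $x>d$. Furthermore, $\bar\omega$ is a modulus of regularity of $\Phi$ on $\mathbb{R}^d$.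
   Context: Here $d\in\mathbb{N}_+$ and $\operatorname{dist}_{[0,1]^d}(\mathbf{x})=\min_{\mathbf{z}\in[0,1]^d}\|\mathbf{z}-\mathbf{x}\|_1$. Modulus of regularity: for $I=[0,\infty)$ or $I=[0,T]$, a function $\omega:I\to[0,\infty)$ with $\omega(0)=0$ that is monotone increasing and concave. It is a modulus of regularity of a function $g$ on $X\subseteq\mathbb{R}^d$ if $|g(\mathbf{x})-g(\mathbf{y})|\le\omega(\|\mathbf{x}-\mathbf{y}\|_1)$ for all $\mathbf{x},\mathbf{y}\in X$ ($\ell^1$ norm). ReLU MLP: a function $\Phi:\mathbb{R}^{d_1}\to\mathbb{R}^{d_{\Delta+1}}$ with a representation $\mathbf{x}^{(1)}=\mathbf{x}$, $\mathbf{x}^{(l+1)}=\operatorname{ReLU}(\mathbf{W}^{(l)}\mathbf{x}^{(l)}+\mathbf{b}^{(l)})$ for $l=1,\dots,\Delta-1$ (ReLU$(t)=\max\{0,t\}$ applied componentwise), $\Phi(\mathbf{x})=\mathbf{W}^{(\Delta)}\mathbf{x}^{(\Delta)}+\mathbf{b}^{(\Delta)}$, where $\mathbf{W}^{(l)}\in\mathbb{R}^{d_{l+1}\times d_l}$ and $\mathbf{b}^{(l)}\in\mathbb{R}^{d_{l+1}}$. Its depth is $\Delta-1$ (number of hidden layers), its width is $\max_{2\le l\le\Delta}d_l$, and the number of nonzero parameters is the total number of nonzero entries of all $\mathbf{W}^{(l)},\mathbf{b}^{(l)}$.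
   Formalization: As printed the bound fails for f uncontrolled off the cube (f=0 on [0,1], x² elsewhere). The formal sup runs over any X containing [0,1]^d on which ω̄ is a modulus of regularity of f; X=R^d gives the displayed sup, X=[0,1]^d needs no extra assumption. *)

(* Defs.v *)
From mathcomp Require Export all_boot all_order all_algebra.
From mathcomp Require Export all_classical all_reals all_analysis.
Set Implicit Arguments.
Unset Strict Implicit.
Unset Printing Implicit Defensive.
Import Order.TTheory GRing.Theory Num.Theory.
Import numFieldNormedType.Exports.
Local Open Scope classical_set_scope.
Local Open Scope ring_scope.

Section Geometry.
Context {R : realType} {d : nat}.
Implicit Types x z : 'cV[R]_d.

Definition l1norm x : R := \sum_(i < d) `|x i 0|.

Definition unit_cube : set 'cV[R]_d :=
  [set x | forall i, 0 <= x i 0 <= 1].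

(* The infimum is attained, the cube being compact and nonempty. *)
Definition dist_cube x : R := inf [set l1norm (z - x) | z in unit_cube].

End Geometry.

Section Modulus.
Context {R : realType}.

(* Moduli are total functions of which only the values on the interval [I]
   matter; [I] is meant to be [0, T] or [0, +oo[. *)
Definition is_modulus (I : set R) (w : R -> R) : Prop :=
  [/\ w 0 = 0,
      forall t, I t -> 0 <= w t,
      {in I &, {homo w : s t / s <= t}} &
      convex_function I (fun t => - w t : R^o)].

Definition modulus_of_regularity {d : nat} (I : set R) (w : R -> R)
    (X : set 'cV[R]_d) (g : 'cV[R]_d -> R) : Prop :=
  is_modulus I w /\
  forall x y, X x -> X y -> `|g x - g y| <= w (l1norm (x - y)).

Definition extend_modulus (T : R) (w : R -> R) : R -> R :=
  fun t => if t <= T then w t else w T.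

End Modulus.

Section ReluMLP.
Context {R : realType}.

(* [Affine W b] is the output layer, [Hidden W b N] puts the hidden layer
   x |-> ReLU (W x + b) in front of N. *)
Inductive mlp : nat -> nat -> Type :=
| Affine m n of 'M[R]_(n, m) & 'cV[R]_n : mlp m n
| Hidden m k n of 'M[R]_(k, m) & 'cV[R]_k & mlp k n : mlp m n.

Definition relu (t : R) : R := Num.max 0 t.

Fixpoint mlp_eval {m n} (N : mlp m n) : 'cV[R]_m -> 'cV[R]_n :=
  match N with
  | Affine _ _ W b => fun x => W *m x + b
  | Hidden _ _ _ W b N' => fun x => mlp_eval N' (map_mx relu (W *m x + b))
  end.

Fixpoint mlp_depth {m n} (N : mlp m n) : nat :=
  match N with
  | Affine _ _ _ _ => 0
  | Hidden _ _ _ _ _ N' => (mlp_depth N').+1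
  end.

Fixpoint mlp_width {m n} (N : mlp m n) : nat :=
  match N with
  | Affine _ _ _ _ => 0
  | Hidden _ k _ _ _ N' => maxn k (mlp_width N')
  end.

Definition nnz {m n} (A : 'M[R]_(m, n)) : nat :=
  #|[set ij : 'I_m * 'I_n | A ij.1 ij.2 != 0]%SET|.

Fixpoint mlp_nparams {m n} (N : mlp m n) : nat :=
  match N with
  | Affine _ _ W b => nnz W + nnz b
  | Hidden _ _ _ W b N' => nnz W + nnz b + mlp_nparams N'
  end.

End ReluMLP.

Arguments mlp R m n : clear implicits.

(* Main.v *)
(* Phi is the piecewise linear interpolation of f on Kuhn's triangulation of
   the grid {0, 1/n, ..., 1}^d, applied to the projection of x onto the cube.
   On the cube it is an average over one uniform shift u in [0, 1):
     Phi(x) = E f(V_x / n),   (V_x)_j = floor (n x_j + u).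
   Using the same u for x and y, every coordinate of V_x is monotone in x_j with
   mean n x_j, so E |V_x - V_y|_1 = n |x - y|_1, and Jensen's inequality for the
   concave modulus gives the regularity of Phi. Likewise
   E |x_j - (V_x)_j / n| = 2 t (1 - t) / n <= 1 / (2 n) for the fractional part
   t of n x_j, which gives the error bound. The weight P(V_x = g) equals
     relu (1 - max_j relu (n x_j - g_j) - max_j relu (g_j - n x_j)),
   and max a b = relu a + relu (b - a) for a >= 0 turns the maxima into binary
   trees of depth log2 d. To stay within 18 d (n+1)^d parameters, the leaves
   relu (n x_j - k), relu (k - n x_j) are shared by all nodes g with g_j = k. *)

From mathcomp Require Import zify ring lra.
Require Import Defs.
Import Order.TTheory GRing.Theory Num.Theory.
Import numFieldNormedType.Exports.
Local Open Scope classical_set_scope.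
Local Open Scope ring_scope.

Set Implicit Arguments.
Unset Strict Implicit.

(** * Sparse networks and trees of maxima *)

Section Nets.
Context {R : realType}.

Definition row_sparse {I J : finType} (W : J -> I -> R) (r : J -> nat) : Prop :=
  forall j, (#|[pred i | W j i != 0%R]| <= r j)%N.

(* Neurons are indexed by arbitrary finite types; [e] numbers the inputs, and
   only the inputs satisfying [P] have a prescribed output. *)
Definition realizes {I : finType} {p} (e : 'I_p -> I) (P : (I -> R) -> Prop)
    (F : (I -> R) -> R) (dep wid par : nat) : Prop :=
  exists N : mlp R p 1,
    [/\ forall v, P v -> mlp_eval N (\col_i v (e i)) 0 0 = F v,
        (mlp_depth N <= dep)%N, (mlp_width N <= wid)%N &
        (mlp_nparams N <= par)%N].

Lemma realizes_weaken (I : finType) p (e : 'I_p -> I) (P P' : (I -> R) -> Prop)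
    F F' dep dep' wid wid' par par' :
  (forall v, P' v -> P v) -> (forall v, P' v -> F v = F' v) ->
  (dep <= dep')%N -> (wid <= wid')%N -> (par <= par')%N ->
  realizes e P F dep wid par -> realizes e P' F' dep' wid' par'.
Proof.
move=> hP hF hd hw hp [N [hN Nd Nw Np]]; exists N; split.
- by move=> v Pv; rewrite hN ?hF //; apply: hP.
- exact: leq_trans hd.
- exact: leq_trans hw.
- exact: leq_trans hp.
Qed.

Lemma nnz_rows m n (A : 'M[R]_(m, n)) (r : 'I_m -> nat) :
  (forall i, (#|[pred j | A i j != 0%R]| <= r i)%N) -> (nnz A <= \sum_i r i)%N.
Proof.
move=> h; rewrite /nnz -sum1dep_card.
rewrite -(pair_big_dep xpredT (fun i j => A i j != 0) (fun _ _ => 1%N)) /=.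
by apply: leq_sum => i _; rewrite sum1_card; apply: h.
Qed.

Lemma nnz0 m n : nnz (0 : 'M[R]_(m, n)) = 0%N.
Proof. by apply: eq_card0 => ij; rewrite !inE mxE eqxx. Qed.

Lemma nnz_le m n (A : 'M[R]_(m, n)) : (nnz A <= m * n)%N.
Proof.
rewrite -[X in (_ <= X * _)%N]card_ord -sum_nat_const; apply: nnz_rows => i.
by apply: leq_trans (max_card _) _; rewrite card_ord.
Qed.

(** Networks are assembled from the output backwards: one layer is put in front of a network whose
    inputs must satisfy [Q], which the new layer guarantees. *)
Lemma realizes_hidden (I J : finType) p (e : 'I_p -> I) (W : J -> I -> R)
    (b : J -> R) (P : (I -> R) -> Prop) (Q : (J -> R) -> Prop) F r dep wid par :
  bijective e -> row_sparse W r ->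
  (forall v, P v -> Q (fun j => relu (\sum_i W j i * v i + b j))) ->
  realizes (@enum_val J predT) Q F dep wid par ->
  realizes e P (fun v => F (fun j => relu (\sum_i W j i * v i + b j)))
    dep.+1 (maxn #|J| wid) (\sum_j r j + #|[pred j | b j != 0%R]| + par).
Proof.
move=> be sW hP [N [hN hd hw hp]].
pose Wm : 'M[R]_(#|J|, p) := \matrix_(j, i) W (enum_val j) (e i).
pose bm : 'cV[R]_#|J| := \col_j b (enum_val j).
have bijv : {on [pred j : J | true], bijective (@enum_val J predT)}.
  by apply: onW_bij; apply: enum_val_bij.
exists (Hidden Wm bm N); split => /=.
- move=> v Pv; rewrite -(hN _ (hP _ Pv)); congr (mlp_eval N _ 0 0).
  apply/matrixP => j k; rewrite !mxE; congr (relu (_ + _)).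
  rewrite [RHS](reindex e) /=; last exact: onW_bij.
  by apply: eq_bigr => i _; rewrite !mxE.
- by rewrite ltnS.
- by rewrite geq_max leq_maxl leq_max hw orbT.
- apply: leq_add hp; apply: leq_add.
    rewrite [X in (_ <= X)%N](reindex (@enum_val J predT)) //=.
    apply: nnz_rows => j; apply: leq_trans (sW (enum_val j)).
    rewrite -(fintype.card_image (bij_inj be)); apply: subset_leq_card.
    by apply/fintype.subsetP => _ /fintype.imageP[i + ->]; rewrite !inE mxE.
  (* The bias is a single column, so each row has at most one nonzero entry. *)
  apply: (@leq_trans (\sum_(j < #|J|) (b (enum_val j) != 0%R)%R)%N).
    apply: nnz_rows => j.
    apply: (@leq_trans #|[pred _ : 'I_1 | b (enum_val j) != 0%R]|).
      by apply: subset_leq_card; apply/fintype.subsetP => k; rewrite !inE mxE.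
    case: (b (enum_val j) != 0); last by apply/eq_leq/eq_card0.
    by apply: leq_trans (max_card _) _; rewrite card_ord.
  rewrite -[X in (_ <= X)%N]sum1_card [X in (_ <= X)%N]big_mkcond.
  by rewrite [X in (_ <= X)%N](reindex (@enum_val J predT)).
Qed.

Lemma realizes_output (I : finType) (c : I -> R) :
  realizes (@enum_val I predT) (fun=> True) (fun v => \sum_i c i * v i) 0 0 #|I|.
Proof.
exists (Affine (\row_i c (enum_val i)) 0); split => //= [v _|].
  rewrite !mxE addr0 [RHS](reindex (@enum_val I predT)) /=; last first.
    by apply: onW_bij; apply: enum_val_bij.
  by apply: eq_bigr => i _; rewrite !mxE.
by rewrite nnz0 addn0 (leq_trans (nnz_le _)) ?mul1n.
Qed.

Lemma card_supportB (I : finType) (f g : I -> R) a b :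
  (#|[pred i | f i != 0%R]| <= a)%N -> (#|[pred i | g i != 0%R]| <= b)%N ->
  (#|[pred i | (f i - g i)%R != 0%R]| <= a + b)%N.
Proof.
move=> fa gb; apply: leq_trans (leq_add fa gb).
rewrite -cardUI; apply: leq_trans (leq_addr _ _); apply: subset_leq_card.
apply/fintype.subsetP => i; rewrite !inE; apply: contraNT.
by rewrite negb_or !negbK => /andP[/eqP -> /eqP ->]; rewrite subrr.
Qed.

Lemma card_support0 (I : finType) : #|[pred i : I | 0%R != 0%R :> R]| = 0%N.
Proof. by apply: eq_card0 => i; rewrite !inE eqxx. Qed.

Lemma relu_maxr (a b : R) : 0 <= a -> relu a + relu (b - a) = Num.max a b.
Proof.
move=> a0; rewrite /relu (max_r a0); case: (leP a b) => ab.
  by rewrite max_r ?subr_ge0 // addrC subrK.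
by rewrite max_l ?addr0 // subr_le0 ltW.
Qed.

(** One level of the tree. Zero is neutral for maxima of nonnegative values, so for odd [e] the last
    value is paired with the padding [V e = 0]. *)
Lemma bigmax_pairs e (V : nat -> R) :
  (forall s, 0 <= V s) -> (forall s, (e <= s)%N -> V s = 0) ->
  \big[Num.max/0]_(t < uphalf e) (relu (V t.*2) + relu (V t.*2.+1 - V t.*2)) =
  \big[Num.max/0]_(j < e) V j.
Proof.
move=> V0 Ve; apply/le_anti/andP; split; apply/bigmax_leP; split.
- exact: bigmax_ge_id.
- have VM s : V s <= \big[Num.max/0]_(j < e) V j.
    case: (ltnP s e) => [se|es]; last by rewrite Ve // bigmax_ge_id.
    exact: (le_bigmax _ _ (Ordinal se)).
  by move=> t _; rewrite relu_maxr // ge_max !VM.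
- exact: bigmax_ge_id.
- move=> j _; have jt : (j./2 < uphalf e)%N.
    rewrite gtn_uphalf_double; apply: leq_ltn_trans (ltn_ord j).
    by rewrite -{2}(odd_double_half j) leq_addl.
  apply: (bigmax_sup (Ordinal jt)) => //=; rewrite relu_maxr // le_max.
  rewrite -{1 3}(odd_double_half j).
  by case: (odd j); rewrite ?add0n ?add1n lexx ?orbT.
Qed.

(** * Two trees of maxima per node *)

Section Tree.
Variables (G : finType) (c : G -> R).

Definition tree_out e (v : G * bool * 'I_e -> R) : R :=
  \sum_g c g * relu (- (\big[Num.max/0]_(j < e) v (g, false, j))
                     - (\big[Num.max/0]_(j < e) v (g, true, j)) + 1).

(** The maximum of one nonnegative value is that value, so nothing is left to merge: each [g] takes
    one neuron with [2 * r] weights and bias 1, and one output weight. *)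
Lemma realizes_leaf r (I : finType) p (en : 'I_p -> I)
    (A : G * bool * 'I_1 -> I -> R) :
  bijective en -> row_sparse A (fun=> r) ->
  realizes en (fun h => forall q, 0 <= \sum_i A q i * h i)
    (fun h => tree_out (fun q => \sum_i A q i * h i))
    1 #|G| (#|G| * (2 * r + 2)).
Proof.
move=> ben sA.
pose W (g : G) i := - A (g, false, ord0) i - A (g, true, ord0) i.
have sW : row_sparse W (fun=> 2 * r)%N.
  move=> g; rewrite mul2n -addnn; apply: card_supportB (sA _).
  apply: leq_trans (sA (g, false, ord0)); apply: subset_leq_card.
  by apply/fintype.subsetP => i; rewrite !inE oppr_eq0.
apply: (@realizes_weaken _ _ _ (fun=> True)); last first.
- apply: (@realizes_hidden _ _ _ _ W (fun=> 1) _ (fun=> True)) => //.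
    exact: sW.
  exact: realizes_output c.
- rewrite sum_nat_const mulnDr -addnA leq_add2l mulnC mul2n -addnn leq_add2r.
  exact: max_card.
- by rewrite maxn0.
- by [].
- move=> h h0; apply: eq_bigr => g _ /=; congr (_ * relu (_ + _)).
  rewrite !big_ord_recl !big_ord0 !max_l //.
  rewrite -opprD -big_split -sumrN; apply: eq_bigr => i _.
  by rewrite /W mulrBl mulNr opprD.
- by [].
Qed.

(* Each of the 2 |G| trees merges [2 t] and [2 t + 1] by the neurons relu a and
   relu (b - a), at cost r + 2 r when values are combinations of r neurons.
   Afterwards r = 2, and halving e repeatedly sums up to at most 24 ((uphalf e) - 1).
   The last hidden neuron and the output weight of each g cost 6. *)
Definition tree_params (r e : nat) : nat :=
  if e == 1%N then 2 * r + 2 else 6 * r * uphalf e + 24 * (uphalf e).-1 + 6.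

(** Induction on [k], one merging layer per step. Tree values are kept as linear combinations of
    neurons, so the sum [relu a + relu (b - a)] is absorbed into the weights of the next layer. *)
Lemma realizes_tree k e r (I : finType) p (en : 'I_p -> I)
    (A : G * bool * 'I_e -> I -> R) :
  bijective en -> (0 < e <= 2 ^ k)%N -> row_sparse A (fun=> r) ->
  realizes en (fun h => forall q, 0 <= \sum_i A q i * h i)
    (fun h => tree_out (fun q => \sum_i A q i * h i))
    k.+1 (#|G| * (4 * e)) (#|G| * tree_params r e).
Proof.
elim: k e r I p en A => [|k IH] e r I p en A ben /andP[e0 ek] sA.
  have e1 : e = 1%N by apply/eqP; rewrite eqn_leq e0 ek.
  move: A sA; rewrite e1 => A sA.
  by apply: realizes_weaken (realizes_leaf ben sA) => //; rewrite leq_pmulr.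
have [e1|e1] := eqVneq e 1%N.
  move: A sA; rewrite e1 => A sA.
  by apply: realizes_weaken (realizes_leaf ben sA) => //; rewrite leq_pmulr.
pose e' := uphalf e.
have e'0 : (0 < e' <= 2 ^ k)%N.
  by rewrite uphalf_gt0 e0 leq_uphalf_double -mul2n -expnS.
(* Zero rows beyond [e] supply the missing partner when [e] is odd. *)
pose AE q s i := if insub s is Some j then A (q, j) i else 0.
have sAE q s : (#|[pred i | AE q s i != 0%R]| <= r)%N.
  by rewrite /AE; case: (insub s) => [j|]; [apply: sA | rewrite card_support0].
pose W (j : G * bool * 'I_e' * bool) i :=
  if j.2 then AE j.1.1 (j.1.2).*2.+1 i - AE j.1.1 (j.1.2).*2 i
  else AE j.1.1 (j.1.2).*2 i.
have sW : row_sparse W (fun j => if j.2 then r + r else r)%N.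
  by move=> [[q t] []]; [apply: card_supportB|]; apply: sAE.
(* Adds the two neurons of one pair, which yields their maximum; hence sparsity 2 from the second
   level on. *)
pose A' (q : G * bool * 'I_e') (j : G * bool * 'I_e' * bool) : R := (q == j.1)%:R.
have A'E q h : \sum_j A' q j * h j = h (q, true) + h (q, false).
  transitivity (\sum_q' \sum_b A' q (q', b) * h (q', b)).
    by rewrite pair_bigA; apply: eq_bigr => -[].
  rewrite (bigD1 q) //= [X in _ + X]big1 => [|q' /negPf q'q]; last first.
    by rewrite big1 // => b _; rewrite /A' /= eq_sym q'q mul0r.
  by rewrite /= addr0 big_bool /A' /= eqxx !mul1r.
have sA' : row_sparse A' (fun=> 2)%N.
  move=> q; have /fintype.card_codom cq : injective (pair q : bool -> _).
    by move=> ? ? [].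
  rewrite -[X in (_ <= X)%N]card_bool -cq; apply: subset_leq_card.
  apply/fintype.subsetP => -[q' b]; rewrite !inE /A' /= pnatr_eq0.
  by case: (q =P q') => [-> _|]; [apply: codom_f | rewrite eqxx].
have AEpos h : (forall q, 0 <= \sum_i A q i * h i) ->
    forall q s, 0 <= \sum_i AE q s i * h i.
  move=> h0 q s; rewrite /AE; case: (insub s) => [j|]; first exact: h0.
  by rewrite big1 // => i _; rewrite mul0r.
apply: realizes_weaken; last first.
- apply: (@realizes_hidden _ _ _ _ W (fun=> 0) _ _ _ _ _ _ _ ben sW); last first.
    exact: (IH e' 2%N _ _ _ A' (enum_val_bij _) e'0 sA').
  instantiate (1 := fun=> True).
  by move=> h _ q; rewrite A'E addr_ge0 // /relu le_max lexx.
- rewrite card_support0 addn0.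
  rewrite (_ : \sum_j _ = \sum_(q : G * bool * 'I_e') (r + r + r))%N; last first.
    transitivity (\sum_(q : G * bool * 'I_e') \sum_b if b then r + r else r)%N.
      by rewrite pair_bigA; apply: eq_bigr => -[].
    by apply: eq_bigr => q _; rewrite big_bool.
  rewrite sum_nat_const !card_prod card_bool card_ord -!mulnA -mulnDr leq_mul2l.
  apply/orP; right; rewrite /tree_params -/e' (negPf e1).
  case: eqP => [->|/eqP e'1]; first by lia.
  (* The layer costs [6 * r * e'] per [g]. The rest amounts to [3 * uphalf e' <= 2 * e'], valid for
     [e' >= 2] with equality at 3. *)
  have := uphalf_half e'; have := odd_double_half e'; lia.
- rewrite geq_max !card_prod card_bool card_ord; apply/andP; split.
    rewrite -!mulnA leq_mul2l; apply/orP; right; rewrite /e'.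
    by have := uphalf_half e; have := odd_double_half e; lia.
  rewrite leq_mul2l; apply/orP; right; rewrite /e'.
  by have := uphalf_half e; have := odd_double_half e; lia.
- by [].
- move=> h h0; apply: eq_bigr => g _ /=; congr (_ * relu (_ + _)).
  have E q : \big[Num.max/0]_(t < e')
      (\sum_j A' (q, t) j * relu (\sum_i W j i * h i + 0)) =
      \big[Num.max/0]_(j < e) \sum_i A (q, j) i * h i.
    transitivity (\big[Num.max/0]_(j < e) \sum_i AE q j i * h i).
      rewrite -(@bigmax_pairs _ (fun j => \sum_i AE q j i * h i)) //.
      - apply: eq_bigr => t _; rewrite A'E !addr0 addrC; congr (_ + relu _).
        by rewrite -sumrB; apply: eq_bigr => i _; rewrite -mulrBl.
      - by apply: AEpos.
      - move=> s es; rewrite big1 // => i _; rewrite /AE insubN ?mul0r //.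
        by rewrite -leqNgt.
    apply: eq_bigr => j _; apply: eq_bigr => i _; rewrite /AE.
    by rewrite valK.
  by rewrite !E.
- by [].
Qed.

End Tree.
End Nets.

(** * The interpolation network *)

Section Interpolant.
Context {R : realType}.
Variables (d n : nat).
Notation grid := {ffun 'I_d -> 'I_n.+1}.

Definition clip (t : R) : R := relu t - relu (t - 1).

(* The nodal function at the node [g] of the linear interpolation on Kuhn's
   triangulation of the grid, in the coordinates [s = n x]. *)
Definition kuhn_hat (g : grid) (s : 'I_d -> R) : R :=
  relu (- (\big[Num.max/0]_(j < d) relu (s j - (g j)%:R))
        - (\big[Num.max/0]_(j < d) relu ((g j)%:R - s j)) + 1).

(** The summands are the costs of the clipping layer ([2 * d] neurons), the leaves ([2 * d * n.+1]
    neurons) and the trees. *)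
Lemma kuhn_params : (0 < d)%N -> (0 < n)%N ->
  (4 * d + (6 * (d * n.+1) + n.+1 ^ d * tree_params 1 d) <= 18 * d * n.+1 ^ d)%N.
Proof.
move=> d0 n0; have [->|d1] := eqVneq d 1%N; first by rewrite /tree_params /= expn1; lia.
have [e dE] : exists e, d = e.+2 by exists d.-2; lia.
have m1 : (2 * d <= n.+1 ^ d)%N.
  apply: (@leq_trans (2 ^ d)); last by rewrite leq_exp2r //; lia.
  by rewrite dE expnS leq_mul2l /=; apply: ltn_expl.
have m2 : (2 * n.+1 <= n.+1 ^ d)%N.
  rewrite dE expnS mulnC leq_mul2l /=; apply: (@leq_trans (2 ^ e.+1)).
    by rewrite expnS leq_pmulr ?expn_gt0.
  by rewrite leq_exp2r //; lia.
set m := (n.+1 ^ d)%N in m1 m2 *.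
have h1 : (6 * (d * n.+1) <= 3 * (d * m))%N.
  have : (d * (2 * n.+1) <= d * m)%N by rewrite leq_mul2l m2 orbT.
  lia.
(* The left side is [30 * uphalf d - 15], and [2 * uphalf d <= d + 1]. The surplus [3 * m] pays for
   [4 * d <= 2 * m]. *)
have h2 : (tree_params 1 d + 3 <= 15 * d)%N.
  rewrite /tree_params (negPf d1); have := uphalf_half d; have := odd_double_half d; lia.
have h3 : (m * (tree_params 1 d + 3) <= m * (15 * d))%N by rewrite leq_mul2l h2 orbT.
nia.
Qed.

Lemma sum_delta (I : finType) (i : I) (F : I -> R) :
  \sum_k (k == i)%:R * F k = F i.
Proof.
rewrite (bigD1 i) //= big1 => [|k /negPf ->]; last by rewrite mul0r.
by rewrite eqxx mul1r addr0.
Qed.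

Lemma card_delta (I : finType) (i : I) :
  (#|[pred k | (k == i)%:R != 0%R :> R]| <= 1)%N.
Proof.
rewrite -(fintype.card1 i); apply: subset_leq_card; apply/fintype.subsetP => k.
by rewrite !inE pnatr_eq0; case: (k == i).
Qed.

(** A layer for the two halves of [clip], a layer for the shared leaves, then the trees: depth 1 + 1
    + ([up_log 2 d] + 1). *)
Lemma kuhn_net (c : grid -> R) : (0 < d)%N -> (0 < n)%N ->
  exists N : mlp R d 1,
    [/\ forall x, mlp_eval N x 0 0 =
          \sum_g c g * kuhn_hat g (fun j => n%:R * clip (x j 0)),
        (mlp_depth N <= up_log 2 d + 3)%N,
        (mlp_width N <= 4 * d * n.+1 ^ d)%N &
        (mlp_nparams N <= 18 * d * n.+1 ^ d)%N].
Proof.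
move=> d0 n0.
(* Each tree input is read from a single shared leaf, so the trees start with [r = 1]. *)
pose A (q : grid * bool * 'I_d) (i : 'I_d * 'I_n.+1 * bool) : R :=
  (i == (q.2, q.1.1 q.2, q.1.2))%:R.
have sA : row_sparse A (fun=> 1%N) by move=> q; apply: card_delta.
pose s (b : bool) : R := if b then -1 else 1.
(* The difference defining [clip] is taken in these weights; the sign [s] selects between
   [n x_j - k] and [k - n x_j]. *)
pose W2 (q : 'I_d * 'I_n.+1 * bool) (i : 'I_d * bool) : R :=
  s q.2 * n%:R * ((i == (q.1.1, false))%:R - (i == (q.1.1, true))%:R).
pose b2 (q : 'I_d * 'I_n.+1 * bool) : R := - s q.2 * (q.1.2)%:R.
have sW2 : row_sparse W2 (fun=> 2%N).
  move=> q; have := card_supportB (card_delta (q.1.1, false))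
    (card_delta (q.1.1, true)).
  apply: leq_trans; apply: subset_leq_card; apply/fintype.subsetP => i.
  by rewrite !inE; apply: contraNN => /eqP h; rewrite /W2 h mulr0.
pose W1 (q : 'I_d * bool) (i : 'I_d) : R := (i == q.1)%:R.
pose b1 (q : 'I_d * bool) : R := if q.2 then -1 else 0.
have sW1 : row_sparse W1 (fun=> 1%N) by move=> q; apply: card_delta.
have dk : (0 < d <= 2 ^ up_log 2 d)%N by rewrite d0 up_logP.
have h3 := realizes_tree c (enum_val_bij _) dk sA.
pose P2 (h : 'I_d * 'I_n.+1 * bool -> R) := forall i, 0 <= h i.
have AE (h : _ -> R) q : \sum_i A q i * h i = h (q.2, q.1.1 q.2, q.1.2).
  exact: sum_delta.
have P2h h : P2 h -> forall q, 0 <= \sum_i A q i * h i by move=> Ph q; rewrite AE.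
have h3' := realizes_weaken P2h (fun _ _ => erefl) (leqnn _) (leqnn _) (leqnn _) h3.
have P2relu (h : 'I_d * bool -> R) : True ->
    P2 (fun j => relu (\sum_i W2 j i * h i + b2 j)).
  by move=> _ i; rewrite /relu le_max lexx.
have h2 := realizes_hidden (enum_val_bij _) sW2 P2relu h3'.
have [|N [hN Nd Nw Np]] := realizes_hidden (b := b1) (P := fun=> True)
    (e := id : 'I_d -> 'I_d) _ sW1 (fun _ _ => I) h2; first by exists id.
exists N; split.
- move=> x; rewrite (_ : x = \col_i x i 0); last first.
    by apply/matrixP => i j; rewrite !mxE (ord1 j).
  rewrite (hN (fun i => x i 0)) //; apply: eq_bigr => g _.
  have E q : relu (\sum_i W2 q i * relu (\sum_k W1 i k * x k 0 + b1 i) + b2 q) =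
     relu (s q.2 * (n%:R * clip (x q.1.1 0) - (q.1.2)%:R)).
    congr relu; rewrite /b2 mulrBr mulNr; congr (_ - _).
    under eq_bigr do rewrite /W2 -!mulrA mulrBl.
    under eq_bigr do rewrite mulrA.
    rewrite -mulr_sumr sumrB !sum_delta /= mulrA; congr (_ * (relu _ - _)).
    by rewrite addr0.
  rewrite /kuhn_hat; congr (_ * relu (- _ - _ + 1)); apply: eq_bigr => j _.
    by rewrite AE E /= mul1r !mxE.
  by rewrite AE E /= mulN1r opprB !mxE.
- by rewrite (leq_trans Nd) // addn3.
- apply: leq_trans Nw _.
  rewrite !geq_max !card_prod card_bool !card_ord card_ffun !card_ord.
  have : (n.+1 <= n.+1 ^ d)%N by rewrite -{1}(expn1 n.+1) leq_pexp2l.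
  set m := (n.+1 ^ d)%N => nm; rewrite mulnC.
  have : (d * n.+1 <= d * m)%N by rewrite leq_mul2l nm orbT.
  have : (d <= d * m)%N by rewrite leq_pmulr // expn_gt0.
  by nia.
- apply: leq_trans Np (leq_trans _ (kuhn_params d0 n0)).
  rewrite !sum_nat_const !card_prod card_bool !card_ord card_ffun !card_ord.
  apply: leq_add.
    apply: leq_trans (leq_add (leqnn _) (max_card _)) _.
    by rewrite card_prod card_bool card_ord; lia.
  apply: leq_add => //.
  apply: leq_trans (leq_add (leqnn _) (max_card _)) _.
  by rewrite !card_prod card_bool !card_ord; lia.
Qed.

End Interpolant.

(** * Kuhn interpolation as an average over shifts *)

Section Coupling.
Context {R : realType}.
Local Notation mu := (@lebesgue_measure R).
Local Notation len A := (fine (mu A)).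

Lemma leq_ltD1 (a b : nat) : (a <= b)%N = (a%:R < b%:R + 1 :> R).
Proof. by rewrite natr1 ltr_nat ltnS. Qed.

Lemma fine_lebesgue_itvco (a b : R) : len `[a, b[ = relu (b - a).
Proof.
rewrite lebesgue_measure_itv /= lte_fin /relu; case: ltP => ab /=.
  by rewrite max_r // subr_ge0 ltW.
by rewrite max_l // subr_le0.
Qed.

Lemma fin_num_unit_itv (A : set R) : measurable A -> A `<=` `[0, 1[ ->
  mu A \is a fin_num.
Proof.
move=> mA A01; rewrite ge0_fin_numE; last exact: measure_ge0.
apply: (@le_lt_trans _ _ (mu `[0, 1[)).
  by apply: le_measure; rewrite ?inE.
by rewrite lebesgue_measure_itv /= lte_fin ltr01 oppr0 adde0 ltry.
Qed.

Lemma len_partition (K : finType) (A : K -> set R) (B : set R) :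
  (forall i, measurable (A i)) -> trivIset setT A -> measurable B ->
  B `<=` `[0, 1[ -> (forall u, B u -> exists i, A i u) ->
  len B = \sum_i len (B `&` A i).
Proof.
move=> mA tA mB B01 cB.
have mBA i : measurable (B `&` A i) by apply: measurableI.
rewrite sum_fine => [|i _]; last first.
  by apply: (fin_num_unit_itv (mBA i)) => u [/B01].
congr fine; rewrite (bigfs _ (r := index_enum K)) ?index_enum_uniq //; last first.
  by move=> i _; rewrite mem_index_enum.
rewrite -measure_fin_bigcup //; last first.
- by move=> i _; exact: mBA.
- by move=> i k _ _ [u [[_ ui] [_ uk]]]; apply: (tA i k I I); exists u.
congr (mu _); apply/seteqP; split => [u Bu|u [i _ []//]].
by have [i Ai] := cB u Bu; exists i.
Qed.

Variables (d n : nat).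
Notation grid := {ffun 'I_d -> 'I_n.+1}.
Implicit Types (s : 'I_d -> R) (g : grid).

(* The shifts u for which rounding every s_j + u down gives the node g. *)
Definition cell s g : set R :=
  [set u | (0 <= u < 1) /\ forall j, (g j)%:R <= s j + u < (g j)%:R + 1].

(** Each coordinate bounds [u] on both sides. The constraint [0 <= u < 1] accounts for the initial
    value 0 of the maxima and for the inner [relu]. *)
Lemma cell_itv s g : cell s g =
  `[\big[Num.max/0]_(j < d) relu ((g j)%:R - s j),
    1 - \big[Num.max/0]_(j < d) relu (s j - (g j)%:R)[%classic.
Proof.
apply/seteqP; split => u /=.
  case=> /andP[u0 u1] h; rewrite in_itv /=; apply/andP; split.
    apply/bigmax_leP; split => // j _; rewrite /relu ge_max u0 /=.
    by have /andP[] := h j; lra.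
  rewrite ltrBrDl -ltrBrDr; apply/bigmax_ltP; split; first by lra.
  by move=> j _; rewrite /relu gt_max; have /andP[] := h j; lra.
rewrite in_itv /= => /andP[/bigmax_leP[u0 uj]].
rewrite ltrBrDl -ltrBrDr => /bigmax_ltP[u1 uj']; split; first by lra.
move=> j; have := uj j isT; have := uj' j isT.
by rewrite /relu ge_max gt_max; lra.
Qed.

Lemma measurable_cell s g : measurable (cell s g).
Proof. by rewrite cell_itv. Qed.

Lemma len_cell s g : len (cell s g) = kuhn_hat g s.
Proof.
rewrite cell_itv fine_lebesgue_itvco /kuhn_hat; congr relu.
by rewrite [RHS]addrC addrA.
Qed.

Lemma cell_unit s g : cell s g `<=` `[0, 1[.
Proof. by move=> u [? _] /=; rewrite in_itv. Qed.

Lemma trivIset_cell s : trivIset setT (cell s).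
Proof.
move=> g g' _ _ [u [[_ h] [_ h']]]; apply/ffunP => j; apply/val_inj.
have hj := h j; have hj' := h' j.
by apply/eqP; rewrite eqn_leq !leq_ltD1; lra.
Qed.

Definition in_box s := forall j, 0 <= s j <= n%:R.

Lemma cell_cover s u : in_box s -> `[0, 1[%classic u -> exists g, cell s g u.
Proof.
rewrite /= in_itv /= => sb u01.
exists [ffun j => inord (Num.truncn (s j + u))]; split => // j.
have := sb j => /andP[s0 sn]; have su0 : 0 <= s j + u by lra.
rewrite ffunE inordK ?natr1 ?truncn_itv // ltnS.
(* As [s j <= n] and [u < 1], the floor is at most [n], so [inord] returns it unchanged. *)
rewrite -ltnS truncn_lt_nat // -natr1; lra.
Qed.

(** The lengths of the intersections are the joint weights of the roundings of [s] and [s'] by the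
    same shift; this is their first marginal. *)
Lemma sum_coupling s s' g : in_box s' ->
  \sum_g' len (cell s g `&` cell s' g') = kuhn_hat g s.
Proof.
move=> sb; rewrite -len_cell.
rewrite [RHS](len_partition (@measurable_cell s') (@trivIset_cell s')) //.
- exact: measurable_cell.
- exact: cell_unit.
- by move=> u /cell_unit; apply: cell_cover.
Qed.

(** With [k] the floor and [t] the fractional part of [s j], the rounded coordinate is [k] for
    [u < 1 - t] and [k + 1] otherwise. [F] is defined on [nat] since [k.+1] exceeds the grid when
    [s j = n], where its weight [t] is 0. *)
Lemma sum_kuhn_coord s j : in_box s -> exists (t : R) (k : nat),
  [/\ 0 <= t <= 1, s j = k%:R + t & forall F : nat -> R,
     \sum_(g : grid) kuhn_hat g s * F (g j) = (1 - t) * F k + t * F k.+1].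
Proof.
move=> sb; have /andP[s0 sn] := sb j.
pose k := Num.truncn (s j); pose t := s j - k%:R.
have /andP[t0 t1] : 0 <= t < 1.
  by have := truncn_itv s0; rewrite -natr1 /t /k; lra.
exists t, k; split; [lra|by rewrite /t addrC subrK|move=> F].
pose C (b : bool) : set R := if b then `[1 - t, 1[%classic else `[0, 1 - t[%classic.
have mC b : measurable (C b) by case: b => /=; exact: measurable_itv.
have C01 b : C b `<=` `[0, 1[.
  by case: b => u /=; rewrite !in_itv /=; lra.
have lenC b : len (C b) = if b then t else 1 - t.
  by case: b; rewrite fine_lebesgue_itvco /relu max_r //; lra.
have CF b : \sum_g len (cell s g `&` C b) * F (g j) = len (C b) * F (k + b)%N.
  rewrite [in RHS](len_partition (@measurable_cell s) (@trivIset_cell s)) //; last first.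
    by move=> u /C01; apply: cell_cover.
  rewrite mulr_suml; apply: eq_bigr => g _; rewrite setIC.
  (* An empty intersection has weight 0; otherwise a common shift [u] forces [g j = k + b]. *)
  have [->|/set0P[u [Cu [u01 gu]]]] := eqVneq (C b `&` cell s g) set0.
    by rewrite measure0 !mul0r.
  congr (_ * F _); have := gu j.
  rewrite (_ : s j = k%:R + t); last by rewrite /t addrC subrK.
  move: Cu; rewrite /C; case: b => /=; rewrite in_itv /= => Cu gj;
    apply/eqP; rewrite eqn_leq !leq_ltD1 ?addn0 ?addn1 -?natr1; lra.
have := CF false; have := CF true; rewrite !lenC addn0 addn1 => <- <-.
rewrite addrC -big_split; apply: eq_bigr => g _; rewrite /= -mulrDl; congr (_ * _).
rewrite -len_cell (@len_partition _ C) ?big_bool //.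
- move=> b b' _ _ [u []]; case: b; case: b' => //=; rewrite !in_itv /=; lra.
- exact: measurable_cell.
- exact: cell_unit.
- move=> u /cell_unit /=; rewrite in_itv /= => u01.
  by case: (ltP u (1 - t)) => ut; [exists false|exists true]; rewrite /= in_itv /=; lra.
Qed.

Lemma sum_kuhn s : in_box s -> (0 < d)%N -> \sum_(g : grid) kuhn_hat g s = 1.
Proof.
move=> sb d0; have [t [k [_ _ h]]] := sum_kuhn_coord (Ordinal d0) sb.
by have := h (fun=> 1); under eq_bigr do rewrite mulr1; move=> ->; lra.
Qed.

Lemma sum_kuhn_dist s j : in_box s ->
  \sum_(g : grid) kuhn_hat g s * `|s j - (g j)%:R| <= 1 / 2.
Proof.
move=> sb; have [t [k [/andP[t0 t1] -> h]]] := sum_kuhn_coord j sb.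
rewrite (h (fun m => `|k%:R + t - m%:R|)) addrAC subrr add0r ger0_norm //.
rewrite ler0_norm -natr1; last by lra.
(* The mean deviation is [2 t (1 - t)], that is, [1 / 2 - 2 (t - 1 / 2)^2]. *)
by have := sqr_ge0 (t - 1 / 2); rewrite expr2; nra.
Qed.

(** Rounding by a common shift preserves order, so the absolute value drops wherever the joint
    weight is nonzero, and a difference of means remains. *)
Lemma coupling_dist_le s s' j : in_box s -> in_box s' -> s' j <= s j ->
  \sum_g \sum_g' len (cell s g `&` cell s' g') * `|(g j)%:R - (g' j)%:R|
    = s j - s' j.
Proof.
move=> sb sb' ss'.
transitivity (\sum_g \sum_g'
    len (cell s g `&` cell s' g') * ((g j)%:R - (g' j)%:R)).
  apply: eq_bigr => g _; apply: eq_bigr => g' _.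
  have [->|/set0P[u [[_ h] [_ h']]]] := eqVneq (cell s g `&` cell s' g') set0.
    by rewrite measure0 !mul0r.
  rewrite ger0_norm // subr_ge0 ler_nat leq_ltD1.
  by have := h j; have := h' j; lra.
have mean r (rb : in_box r) : \sum_(g : grid) kuhn_hat g r * (g j)%:R = r j.
  have [t [k [_ -> ->]]] := sum_kuhn_coord j rb; rewrite -natr1; lra.
under eq_bigr do
  (under eq_bigr do rewrite mulrBr; rewrite sumrB -mulr_suml sum_coupling //).
rewrite sumrB mean // exchange_big /=; congr (_ - _).
rewrite -[RHS]mean //; apply: eq_bigr => g' _; rewrite -mulr_suml; congr (_ * _).
by rewrite -(sum_coupling s' g' sb); apply: eq_bigr => g _; rewrite setIC.
Qed.

Lemma coupling_dist s s' j : in_box s -> in_box s' ->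
  \sum_g \sum_g' len (cell s g `&` cell s' g') * `|(g j)%:R - (g' j)%:R|
    = `|s j - s' j|.
Proof.
move=> sb sb'; have [ss'|/ltW ss'] := leP (s' j) (s j).
  by rewrite coupling_dist_le // ger0_norm // subr_ge0.
rewrite distrC ger0_norm ?subr_ge0 // -coupling_dist_le // exchange_big /=.
by apply: eq_bigr => g _; apply: eq_bigr => g' _; rewrite setIC distrC.
Qed.

End Coupling.

(** * Moduli and approximation *)

Section Modulus.
Context {R : realType}.

Lemma modulus_concave (I : set R) (w : R -> R) (t s1 s2 : R) :
  is_modulus I w -> 0 <= t <= 1 -> I s1 -> I s2 ->
  t * w s1 + (1 - t) * w s2 <= w (t * s1 + (1 - t) * s2).
Proof.
move=> [_ _ _ cw] /andP[t0 t1] I1 I2.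
have := cw (Itv01 t0 t1) s1 s2; rewrite !inE => /(_ I1 I2).
by rewrite !convRE /= /unstable.onem !mulrN -opprD lerN2.
Qed.

Lemma extend_modulusE (T : R) (w : R -> R) t :
  extend_modulus T w t = w (Num.min t T).
Proof. by rewrite /extend_modulus minElt; case: ltgtP => // ->. Qed.

(** The extension is [w] after truncation at [T]: a monotone concave function composed with a
    concave one is concave. *)
Lemma is_modulus_extend (T : R) (w : R -> R) : 0 <= T ->
  is_modulus `[0, T] w -> is_modulus `[0, +oo[ (extend_modulus T w).
Proof.
move=> T0 mw; have [w0 wpos wmono _] := mw.
have inT (t : R) : `[0, +oo[%classic t -> `[0, T]%classic (Num.min t T).
  by rewrite /= !in_itv /= andbT => t0; rewrite le_min t0 T0 ge_min lexx orbT.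
split.
- by rewrite extend_modulusE min_l.
- by move=> t /inT It; rewrite extend_modulusE wpos.
- move=> s t; rewrite !inE => /inT Is /inT It st.
  by rewrite !extend_modulusE; apply: wmono; rewrite ?inE // le_min !ge_min st lexx orbT.
- move=> t s1 s2; rewrite !inE => I1 I2; rewrite !convRE !mulrN -opprD lerN2.
  rewrite /unstable.onem !extend_modulusE.
  have -> : conv t s1 s2 = t%:num * s1 + (1 - t%:num) * s2 :> R by [].
  have t0 : 0 <= t%:num :> R by [].
  have t1 : t%:num <= 1 :> R by [].
  move: t0 t1; move: (t%:num : R) => a a0 a1.
  have a01 : 0 <= a <= 1 by rewrite a0.
  apply: le_trans (modulus_concave mw a01 (inT _ I1) (inT _ I2)) _.
  have := inT _ I2; have := inT _ I1; move: I1 I2.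
  rewrite /= !in_itv /= !andbT => s10 s20 /andP[m10 m1T] /andP[m20 m2T].
  set m1 := Num.min s1 T in m10 m1T *; set m2 := Num.min s2 T in m20 m2T *.
  have m1s : m1 <= s1 by rewrite ge_min lexx.
  have m2s : m2 <= s2 by rewrite ge_min lexx.
  have mT : a * m1 + (1 - a) * m2 <= T by nra.
  have ms : a * m1 + (1 - a) * m2 <= a * s1 + (1 - a) * s2.
    by apply: lerD; apply: ler_wpM2l => //; rewrite subr_ge0.
  apply: wmono; rewrite ?inE /= ?in_itv /= ?le_min ?mT ?ms ?T0 ?ge_min ?lexx
    ?orbT ?andbT //.
    by apply: addr_ge0; apply: mulr_ge0 => //; rewrite subr_ge0.
  by apply: addr_ge0; apply: mulr_ge0 => //; rewrite subr_ge0.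
Qed.

Lemma jensen_modulus (I : finType) (p z : I -> R) (w : R -> R) :
  is_modulus `[0, +oo[ w -> (forall i, 0 <= p i) -> (forall i, 0 <= z i) ->
  \sum_i p i = 1 -> \sum_i p i * w (z i) <= w (\sum_i p i * z i).
Proof.
move=> mw p0 z0 p1.
(* Partial sums of weights are not 1, so the induction runs on the inequality normalized by [S]. *)
suff H (r : seq I) :
    let S := \sum_(i <- r) p i in let Z := \sum_(i <- r) p i * z i in
    0 < S -> \sum_(i <- r) p i * w (z i) <= S * w (Z / S).
  by have := H (index_enum I); rewrite /= p1 divr1 mul1r; apply.
elim: r => [|i r IH] /=; first by rewrite big_nil ltxx.
rewrite !big_cons.
set S := \sum_(j <- r) p j in IH *; set Z := \sum_(j <- r) p j * z j in IH *.
have S0 : 0 <= S by apply: sumr_ge0.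
have Z0 : 0 <= Z by apply: sumr_ge0 => j _; rewrite mulr_ge0.
have Iz (t : R) : 0 <= t -> `[0, +oo[%classic t by rewrite /= in_itv /= => ->.
move: S0; rewrite le_eqVlt => /predU1P[S0|S0] P0.
  have pr j : j \in r -> p j = 0.
    move=> jr; apply/eqP; move/esym/eqP: S0; rewrite psumr_eq0 // => /allP.
    by move/(_ j jr).
  rewrite -S0 addr0 in P0 *.
  have -> : Z = 0 by rewrite /Z big_seq big1 // => j /pr ->; rewrite mul0r.
  rewrite big_seq big1 => [|j /pr ->]; last by rewrite mul0r.
  by rewrite !addr0 mulrAC mulfV ?mul1r ?lt0r_neq0.
(* Concavity is applied to [z i] and the mean [Z / S] of the tail, with this weight on [z i]. *)
have t01 : 0 <= p i / (p i + S) <= 1.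
  by rewrite divr_ge0 ?(ltW P0) //= ler_pdivrMr // mul1r lerDl ltW.
have c := modulus_concave mw t01 (Iz _ (z0 i))
  (Iz _ (divr_ge0 Z0 (ltW S0))).
apply: le_trans (lerD (lexx _) (IH S0)) _.
have nz : p i + S != 0 by rewrite lt0r_neq0.
have nS : S != 0 by rewrite lt0r_neq0.
have := ler_wpM2l (ltW P0) c; set a := w (z i); set b := w (Z / S).
rewrite (_ : _ * (_ * a + _ * b) = p i * a + S * b); last by field.
rewrite (_ : _ * z i + _ * (Z / S) = (p i * z i + Z) / (p i + S)) //.
by field; rewrite nS nz.
Qed.

Lemma clip_bounds (t : R) : 0 <= clip t <= 1.
Proof. by rewrite /clip /relu; case: (leP 0 t); case: (leP 0 (t - 1)); lra. Qed.

Lemma clip_dist (s t : R) : `|clip s - clip t| <= `|s - t|.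
Proof.
rewrite /clip /relu ler_norml; have := ler_norm (s - t); have := ler_norm (t - s).
rewrite (distrC t s); case: (leP 0 t); case: (leP 0 (t - 1));
  case: (leP 0 s); case: (leP 0 (s - 1)); lra.
Qed.

Lemma clip_closest (t z : R) : 0 <= z <= 1 -> `|t - clip t| <= `|z - t|.
Proof.
rewrite /clip /relu ler_norml => z01.
have := ler_norm (z - t); have := ler_norm (t - z); rewrite (distrC t z).
by case: (leP 0 t); case: (leP 0 (t - 1)); lra.
Qed.

End Modulus.

(** * Error and regularity of the interpolant of [f] *)

Section Approximation.
Context {R : realType}.
Variables (d n : nat) (w : R -> R) (f : 'cV[R]_d -> R).
Hypotheses (d_gt0 : (0 < d)%N) (n_gt0 : (0 < n)%N).
Hypothesis hf : modulus_of_regularity `[0, d%:R] w unit_cube f.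
Notation grid := {ffun 'I_d -> 'I_n.+1}.
Let wbar := extend_modulus d%:R w.

Definition node (g : grid) : 'cV[R]_d := \col_j ((g j)%:R / n%:R).
Definition clip_cube (x : 'cV[R]_d) : 'cV[R]_d := \col_j clip (x j 0).
Definition scaled (x : 'cV[R]_d) (j : 'I_d) : R := n%:R * x j 0.
Definition kuhn_interp (x : 'cV[R]_d) : R :=
  \sum_g f (node g) * kuhn_hat g (scaled x).

Let nR : 0 < n%:R :> R. Proof. by rewrite ltr0n. Qed.

Lemma l1norm_ge0 (x : 'cV[R]_d) : 0 <= l1norm x.
Proof. by apply: sumr_ge0. Qed.

Lemma wbar_modulus : is_modulus `[0, +oo[ wbar.
Proof. by apply: is_modulus_extend => //; case: hf. Qed.

Lemma wbar_mono s t : 0 <= s -> s <= t -> wbar s <= wbar t.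
Proof.
move=> s0 st; have [_ _ mono _] := wbar_modulus; apply: mono => //;
  by rewrite inE /= in_itv /= andbT // (le_trans s0).
Qed.

(** The cube has l1 diameter at most [d], so the truncation in [wbar] has no effect. *)
Lemma cube_reg x y : unit_cube x -> unit_cube y ->
  `|f x - f y| <= wbar (l1norm (x - y)).
Proof.
move=> cx cy; apply: le_trans (hf.2 _ _ cx cy) _.
rewrite /wbar extend_modulusE min_l // /l1norm.
rewrite -[X in _ <= X%:R](card_ord d) -sumr_const; apply: ler_sum => i _.
by rewrite !mxE ler_norml; have := cx i; have := cy i; lra.
Qed.

Lemma node_cube g : unit_cube (node g).
Proof.
move=> j; rewrite mxE divr_ge0 //= ler_pdivrMr // mul1r ler_nat -ltnS.
exact: ltn_ord.
Qed.

Lemma clip_cubeP x : unit_cube (clip_cube x).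
Proof. by move=> j; rewrite mxE clip_bounds. Qed.

Lemma scaled_box x : unit_cube x -> in_box n (scaled x).
Proof.
move=> cx j; have /andP[x0 x1] := cx j.
by rewrite /scaled mulr_ge0 //= -[X in _ <= X]mulr1 ler_pM2l.
Qed.

Lemma dist_scaled (x : 'cV[R]_d) j (m : nat) :
  `|x j 0 - m%:R / n%:R| = `|scaled x j - m%:R| / n%:R.
Proof.
rewrite -[in RHS](gtr0_norm nR) -normfV -normrM; congr `|_|.
by rewrite /scaled; field; rewrite lt0r_neq0.
Qed.

Lemma kuhn_interp_error x : unit_cube x ->
  `|f x - kuhn_interp x| <= wbar (d%:R / (2 * n%:R)).
Proof.
move=> cx; have sb := scaled_box cx; have k1 := sum_kuhn sb d_gt0.
have k0 (g : grid) : 0 <= kuhn_hat g (scaled x) by rewrite /kuhn_hat /relu le_max lexx.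
have -> : f x - kuhn_interp x = \sum_g kuhn_hat g (scaled x) * (f x - f (node g)).
  under [RHS]eq_bigr do rewrite mulrBr; rewrite sumrB -mulr_suml k1 mul1r.
  by congr (_ - _); apply: eq_bigr => g _; rewrite mulrC.
apply: le_trans (ler_norm_sum _ _ _) _.
apply: (@le_trans _ _ (\sum_g kuhn_hat g (scaled x) * wbar (l1norm (x - node g)))).
  apply: ler_sum => g _; rewrite normrM (ger0_norm (k0 g)).
  by apply: ler_wpM2l => //; apply: cube_reg => //; apply: node_cube.
apply: le_trans (jensen_modulus wbar_modulus k0 _ k1) _.
  by move=> g; apply: l1norm_ge0.
apply: wbar_mono; first by apply: sumr_ge0 => g _; rewrite mulr_ge0 ?l1norm_ge0.
under eq_bigr do rewrite /l1norm mulr_sumr.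
(* The bound is split evenly over the coordinates. *)
have -> : d%:R / (2 * n%:R) = \sum_(j < d) (2 * n%:R)^-1 :> R.
  by rewrite sumr_const card_ord mulr_natl.
rewrite exchange_big /=.
apply: ler_sum => j _.
rewrite (_ : \sum_g _ = (\sum_(g : grid) kuhn_hat g (scaled x) *
    `|scaled x j - (g j)%:R|) / n%:R).
  by rewrite invfM -[2^-1]mul1r ler_pM2r ?invr_gt0 // sum_kuhn_dist.
by rewrite mulr_suml; apply: eq_bigr => g _; rewrite -mulrA !mxE dist_scaled.
Qed.

(** Both values are averages over the same weights [p] on pairs of nodes, whose marginals are the
    nodal functions at [x] and [y]; Jensen then leaves the mean distance of the two nodes. *)
Lemma kuhn_interp_reg x y : unit_cube x -> unit_cube y ->
  `|kuhn_interp x - kuhn_interp y| <= wbar (l1norm (x - y)).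
Proof.
move=> cx cy; have sx := scaled_box cx; have sy := scaled_box cy.
pose p (q : grid * grid) : R :=
  fine (@lebesgue_measure R (cell (scaled x) q.1 `&` cell (scaled y) q.2)).
have p0 q : 0 <= p q by rewrite fine_ge0 // measure_ge0.
have pE (F : grid -> grid -> R) : \sum_q p q * F q.1 q.2 =
    \sum_g \sum_g' p (g, g') * F g g'.
  by rewrite pair_bigA; apply: eq_bigr => -[].
have px F : \sum_q p q * F q.1 = \sum_(g : grid) kuhn_hat g (scaled x) * F g.
  rewrite (pE (fun g _ => F g)); apply: eq_bigr => g _.
  by rewrite -mulr_suml sum_coupling.
have py F : \sum_q p q * F q.2 = \sum_(g : grid) kuhn_hat g (scaled y) * F g.
  rewrite (pE (fun _ g => F g)) exchange_big; apply: eq_bigr => g _.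
  rewrite -mulr_suml -(sum_coupling (scaled y) g sx); congr (_ * _).
  by apply: eq_bigr => g' _; rewrite /p /= setIC.
have p1 : \sum_q p q = 1.
  rewrite -(sum_kuhn sx d_gt0) -[LHS]mulr1 mulr_suml (px (fun=> 1)).
  by apply: eq_bigr => g _; rewrite mulr1.
have -> : kuhn_interp x - kuhn_interp y = \sum_q p q * (f (node q.1) - f (node q.2)).
  under [RHS]eq_bigr do rewrite mulrBr.
  rewrite sumrB (px (f \o node)) (py (f \o node)).
  by congr (_ - _); apply: eq_bigr => g _; rewrite mulrC.
apply: le_trans (ler_norm_sum _ _ _) _.
apply: (@le_trans _ _ (\sum_q p q * wbar (l1norm (node q.1 - node q.2)))).
  apply: ler_sum => q _; rewrite normrM (ger0_norm (p0 q)).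
  by apply: ler_wpM2l => //; apply: cube_reg; apply: node_cube.
apply: le_trans (jensen_modulus wbar_modulus p0 _ p1) _.
  by move=> q; apply: l1norm_ge0.
apply: wbar_mono; first by apply: sumr_ge0 => q _; rewrite mulr_ge0 ?l1norm_ge0.
under eq_bigr do rewrite /l1norm mulr_sumr.
rewrite exchange_big /=; apply: ler_sum => j _.
rewrite (_ : \sum_q _ = (\sum_q p q * `|(q.1 j)%:R - (q.2 j)%:R|) / n%:R).
  rewrite (pE (fun g g' => `|(g j)%:R - (g' j)%:R|)) coupling_dist //.
  rewrite !mxE -[X in _ <= X]mul1r ler_pdivrMr // mul1r /scaled -mulrBr.
  by rewrite normrM gtr0_norm // mulrC.
rewrite mulr_suml; apply: eq_bigr => q _; rewrite -mulrA !mxE -mulrBl.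
by rewrite normrM (gtr0_norm (_ : 0 < n%:R^-1)) ?invr_gt0.
Qed.

Lemma clip_cube_nonexp x y : l1norm (clip_cube x - clip_cube y) <= l1norm (x - y).
Proof. by apply: ler_sum => j _; rewrite !mxE clip_dist. Qed.

(** Clipping is nearest in every coordinate, hence in the l1 norm, which is a sum over
    coordinates. *)
Lemma dist_cube_clip x : l1norm (x - clip_cube x) <= dist_cube x.
Proof.
apply: lb_le_inf.
  by exists (l1norm (clip_cube x - x)), (clip_cube x) => //; apply: clip_cubeP.
move=> _ [z cz <-]; apply: ler_sum => j _; rewrite !mxE.
by apply: clip_closest; apply: cz.
Qed.

End Approximation.
Unset Implicit Arguments.

(** Regularity on the cube does not constrain [f] elsewhere, so the error is bounded on every [X]
    containing the cube on which [f] has modulus [wbar]. For [X = unit_cube] that condition follows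
    from [hf]; [X = setT] gives the bound on the whole space. *)
Theorem corollary5p2 (R : realType) (d n : nat) (hd : (0 < d)%N) (hn : (0 < n)%N)
    (w : R -> R) (f : 'cV[R]_d -> R)
    (hf : modulus_of_regularity `[0, d%:R] w unit_cube f) :
  let wbar := extend_modulus d%:R w in
  exists N : mlp R d 1,
    let Phi := fun x : 'cV[R]_d => mlp_eval N x 0 0 in
    [/\ (mlp_width N <= 8 * d * n.+1 ^ d)%N,
        (mlp_depth N <= up_log 2 d + 5)%N,
        (mlp_nparams N <= 18 * d * n.+1 ^ d)%N,
        forall X : set 'cV[R]_d, unit_cube `<=` X ->
          modulus_of_regularity `[0, +oo[ wbar X f ->
          (ereal_sup [set (`|f x - Phi x| - wbar (dist_cube x))%:E | x in X]
            <= (wbar (d%:R / (2 * n%:R)))%:E)%E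
      & modulus_of_regularity `[0, +oo[ wbar setT Phi].
Proof.
move=> wbar.
have [N [NE Nd Nw Np]] := kuhn_net (fun g => f (node g)) hd hn.
have PhiE x : mlp_eval N x 0 0 = kuhn_interp n f (clip_cube x).
  rewrite NE; apply: eq_bigr => g _; congr (_ * kuhn_hat _ _).
  by apply/funext => j; rewrite /scaled mxE.
exists N => Phi; split.
- by apply: leq_trans Nw _; rewrite !leq_mul2r !orbT.
- by apply: leq_trans Nd _; rewrite leq_add2l.
- exact: Np.
- move=> X cX [mw fX]; apply: ge_ereal_sup => _ [x Xx <-]; rewrite lee_fin lerBlDr.
  rewrite /Phi PhiE [leRHS]addrC.
  (* Passing through [f (clip_cube x)] separates the distance to the cube from the interpolation
     error inside it. *)
  rewrite -[f x](subrK (f (clip_cube x))) -addrA; apply: le_trans (ler_normD _ _) _.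
  apply: lerD; last exact: (kuhn_interp_error hd hn hf (clip_cubeP x)).
  apply: le_trans (fX _ _ Xx (cX _ (clip_cubeP x))) _.
  by apply: (wbar_mono hf (l1norm_ge0 _)); apply: dist_cube_clip.
- split; first exact: (wbar_modulus hf).
  move=> x y _ _; rewrite /Phi !PhiE.
  apply: le_trans (kuhn_interp_reg hd hn hf (clip_cubeP x) (clip_cubeP y)) _.
  by apply: (wbar_mono hf (l1norm_ge0 _)); apply: clip_cube_nonexp.
Qed.
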